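(* Let $S$ be a finite non-commutative completely $0$-simple semigroup. If the commuting graph $\mathcal{G}(S)$ contains left paths, then the knit degree of $S$ is equal to $1$.
   Context: A semigroup $S$ with a zero $0$ is completely $0$-simple if it is $0$-simple (it is not a null semigroup and its only ideals are $\{0\}$ and $S$) and it contains a primitive idempotent (an idempotent that is minimal among the non-zero idempotents, in the natural partial order of idempotents). The commuting graph $\mathcal{G}(S)$ of a finite non-commutative semigroup $S$ is the simple graph with vertex set $S\setminus Z(S)$, where $Z(S)$ is the center of $S$, and where distinct vertices $x,y$ are adjacent iff $xy=yx$. A left path in $\mathcal{G}(S)$ is a path $x_1,\ldots,x_n$ in $\mathcal{G}(S)$ such that $x_1\neq x_n$ and $x_1x_i=x_nx_i$ for all $i\in\{1,\ldots,n\}$. If $\mathcal{G}(S)$ contains left paths, the knit degree of $S$ is the length (number of edges) of a shortest left path in $\mathcal{G}(S)$. *)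

(* Defs.v *)
From HB Require Import structures.
From mathcomp Require Import all_boot.

Set Implicit Arguments.
Unset Strict Implicit.
Unset Printing Implicit Defensive.

#[short(type="finSemigroupType")]
HB.structure Definition FinSemigroup := {S of Semigroup S & Finite S}.

Notation "x * y" := (mul x y) : group_scope.
Local Open Scope group_scope.

Section CompletelyZeroSimple.

Variable S : finSemigroupType.
Implicit Types (z e f x y : S) (I : {set S}).

Definition is_zero z : Prop := forall x, z * x = z /\ x * z = z.

Definition null_semigroup z : Prop := forall x y, x * y = z.

Definition is_ideal I : Prop :=
  I != set0 /\ forall a x, a \in I -> x * a \in I /\ a * x \in I.

Definition zero_simple z : Prop :=
  ~ null_semigroup z /\
  forall I, is_ideal I -> I = [set z] \/ I = [set: S].

Definition idempotent_elt e : Prop := e * e = e.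

Definition natural_le e f : Prop := e * f = e /\ f * e = e.

Definition primitive_idempotent z e : Prop :=
  [/\ idempotent_elt e, e <> z &
      forall f, idempotent_elt f -> f <> z -> natural_le f e -> f = e].

Definition completely_zero_simple z : Prop :=
  zero_simple z /\ exists e, primitive_idempotent z e.

End CompletelyZeroSimple.

Definition noncommutative (S : finSemigroupType) : Prop :=
  exists x y : S, x * y <> y * x.

Definition center (S : finSemigroupType) : {set S} :=
  [set x | [forall y, x * y == y * x]].

Section CommutingGraph.

Variable S : finSemigroupType.
Implicit Types (x y : S) (p : seq S).

Definition cg_vertices : {set S} := ~: center S.

Definition cg_adj : rel S :=
  fun x y => [&& x \in cg_vertices, y \in cg_vertices, x != y & x * y == y * x].

(* The path x_1, ..., x_n is given by its first vertex x = x_1 and its tail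
   p = [:: x_2; ...; x_n]; it has size p edges and last vertex last x p. *)
Definition cg_path x p : bool :=
  [&& x \in cg_vertices, path cg_adj x p & uniq (x :: p)].

Definition left_path x p : bool :=
  [&& cg_path x p, x != last x p &
      all (fun y => x * y == last x p * y) (x :: p)].

Definition left_path_of_length (n : nat) : bool :=
  [exists x : S, exists p : n.-tuple S, left_path x p].

End CommutingGraph.

Definition has_left_paths (S : finSemigroupType) : Prop :=
  exists n, left_path_of_length S n.

Definition knit_degree (S : finSemigroupType) (hS : has_left_paths S) : nat :=
  ex_minn hS.

(* Main.v *)
Require Import Defs.
From mathcomp Require Import all_boot.

(** Let a, b be the endpoints of a left path.  If a^2 = 0 then b^2 = 0 as
    well, and a, b themselves form a left path.  If a^2 <> 0, stability of
    finite 0-simple semigroups gives b in aS, and some vertex x of the path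
    satisfies ax = 0: otherwise commutation would propagate membership in Sa
    along the path up to b, and then aa = ba would force a = b.  Choosing s
    with xsa <> 0, the elements u = xsa and v = xsb are distinct, and all
    products of two elements of {u, v} vanish because ax = bx = 0; nonzero
    elements of square zero are not central, so u, v is a left path. *)

Set Implicit Arguments.
Unset Strict Implicit.
Unset Printing Implicit Defensive.

(** * Stability in finite semigroups *)

Lemma eq_of_subset_imset (T : finType) (f : T -> T) (X Y : {set T}) :
  Y \subset X -> X \subset f @: Y -> Y = X.
Proof.
move=> sYX sXfY; apply/eqP; rewrite eqEcard sYX /=.
exact: leq_trans (subset_leq_card sXfY) (leq_imset_card _ _).
Qed.

Section FiniteSemigroup.

Local Open Scope group_scope.

Variable S : finSemigroupType.
Implicit Types a p t : S.

(* [S^1 a = S^1 p a t] has at most as many elements as its subset [S^1 p a]. *)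
Lemma left_stability p a t : p * a * t = a -> exists w, w * (p * a) = a.
Proof.
move=> pat; pose L c := c |: [set w * c | w in [set: S]].
have LP : L (p * a) = L a.
  apply: (@eq_of_subset_imset _ (fun w => w * t)).
    apply/subsetP=> c /setU1P[->|/imsetP[w _ ->]]; apply/setU1P; right.
      by apply/imsetP; exists p.
    by rewrite mulgA; apply/imsetP; exists (w * p).
  apply/subsetP=> c /setU1P[->|/imsetP[w _ ->]]; apply/imsetP.
    by exists (p * a) => //; apply: setU11.
  exists (w * (p * a)); last by rewrite -mulgA pat.
  by apply/setU1P; right; apply/imsetP; exists w.
have : a \in L (p * a) by rewrite LP setU11.
case/setU1P=> [pa|/imsetP[w _ wE]]; last by exists w; rewrite -wE.
by exists p; rewrite -!pa.
Qed.

(** The dual count: [a S^1 = p a t S^1] is the image of [a t S^1] under left multiplication by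
    [p]. *)
Lemma right_stability p a t : p * a * t = a -> exists w, a * t * w = a.
Proof.
rewrite -mulgA => pat; pose L c := c |: [set c * w | w in [set: S]].
have LP : L (a * t) = L a.
  apply: (@eq_of_subset_imset _ (fun w => p * w)).
    apply/subsetP=> c /setU1P[->|/imsetP[w _ ->]]; apply/setU1P; right.
      by apply/imsetP; exists t.
    by rewrite -mulgA; apply/imsetP; exists (t * w).
  apply/subsetP=> c /setU1P[->|/imsetP[w _ ->]]; apply/imsetP.
    by exists (a * t) => //; apply: setU11.
  exists (a * t * w); last by rewrite mulgA pat.
  by apply/setU1P; right; apply/imsetP; exists w.
have : a \in L (a * t) by rewrite LP setU11.
case/setU1P=> [pa|/imsetP[w _ wE]]; last by exists w; rewrite -wE.
by exists t; rewrite -!pa.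
Qed.

Lemma left_path_of_length1 (x y : S) :
  x \notin center S -> y \notin center S -> x <> y ->
  x * x = y * x -> x * y = y * x -> x * y = y * y ->
  left_path_of_length S 1.
Proof.
move=> xC yC /eqP xy xxyx xyyx xyyy.
apply/existsP; exists x; apply/existsP; exists [tuple y].
by rewrite /left_path /cg_path /cg_adj /cg_vertices /= !in_setC xC yC mem_seq1 xy
  xxyx xyyx -xyyy xyyx !eqxx.
Qed.

End FiniteSemigroup.

(** * Finite 0-simple semigroups *)

Section ZeroSimple.

Local Open Scope group_scope.

Variables (S : finSemigroupType) (z : S).
Hypotheses (hz : is_zero z) (hS : zero_simple z).
Implicit Types a b x y : S.

Lemma zero_mul x : z * x = z. Proof. by case: (hz x). Qed.
Lemma mul_zero x : x * z = z. Proof. by case: (hz x). Qed.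

(** Products form an ideal, which is not [[set z]] because [S] is not null. *)
Lemma zero_simple_mulE x : exists u v, x = u * v.
Proof.
have [nnull simple] := hS.
pose I := [set u * v | u in [set: S], v in [set: S]].
have II : is_ideal I.
  split; first by apply/set0Pn; exists (z * z); apply/imset2P; exists z z.
  move=> a y _; split; first by apply/imset2P; exists y a.
  by apply/imset2P; exists a y.
case: (simple I II) => IE.
  by case: nnull => u v; apply/set1P; rewrite -IE; apply/imset2P; exists u v.
have : x \in I by rewrite IE inE.
by case/imset2P=> u v _ _ ->; exists u, v.
Qed.

Lemma zero_simple_generated a x : a <> z -> exists r t, x = r * a * t.
Proof.
move=> a0; have [nnull simple] := hS.
pose I := [set r * a * t | r in [set: S], t in [set: S]].
have memI r c t : r * a * t * c \in I.
  by apply/imset2P; exists r (t * c); rewrite ?mulgA.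
have II : is_ideal I.
  split; first by apply/set0Pn; exists (z * a * z); apply/imset2P; exists z z.
  move=> _ y /imset2P[r t _ _ ->]; split; last exact: memI.
  by apply/imset2P; exists (y * r) t; rewrite ?mulgA.
case: (simple I II) => IE; last first.
  have : x \in I by rewrite IE inE.
  by case/imset2P=> r t _ _ ->; exists r, t.
(* Otherwise [SaS = 0], so the ideal of all such [a] is [S], and [S^3 = 0]. *)
pose J := [set b | [forall r, forall t, r * b * t == z]].
have JP b : reflect (forall r t, r * b * t = z) (b \in J).
  rewrite inE; apply: (iffP forallP) => [h r t|h r].
    by apply/eqP; move/forallP: (h r).
  by apply/forallP=> t; rewrite h.
have aJ : a \in J.
  apply/JP=> r t; apply/set1P; rewrite -IE; apply/imset2P.
  by exists r t.
have JI : is_ideal J.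
  split; first by apply/set0Pn; exists a.
  move=> b y /JP bJ; split; apply/JP=> r t.
    by rewrite mulgA bJ.
  by rewrite mulgA -(mulgA (r * b)) bJ.
case: (simple J JI) => JE; first by move: aJ; rewrite JE => /set1P.
(* Factoring [u] turns [u * v] into a triple product with middle factor in [J], so [S] would be
   null. *)
case: nnull => u v; have [u1 [u2 ->]] := zero_simple_mulE u.
by have /JP-> : u2 \in J by rewrite JE inE.
Qed.

(** If [x S y] were zero, any [u] in [S x S] and [v] in [S y S] would have product zero; these sets
    are all of [S]. *)
Lemma zero_simple_prime x y : x <> z -> y <> z -> exists s, x * s * y <> z.
Proof.
move=> x0 y0; have [/existsP[s /eqP sP]|/existsPn xSy] :=
  boolP [exists s, x * s * y != z]; first by exists s.
case: hS => nnull _; case: nnull => u v.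
have [r [t ->]] := zero_simple_generated u x0.
have [r' [t' ->]] := zero_simple_generated v y0.
have /negPn/eqP xy := xSy (t * r').
have -> : r * x * t * (r' * y * t') = r * (x * (t * r') * y) * t'.
  by rewrite !mulgA.
by rewrite xy mul_zero zero_mul.
Qed.

(** Simplicity gives [a = r * (y * a) * t]; stability then removes the right factor [t]. *)
Lemma zero_simple_left_stable y a : y * a <> z -> exists r, r * (y * a) = a.
Proof.
move=> ya; have [r [t aE]] := zero_simple_generated a ya.
have [|w wE] := @left_stability _ (r * y) a t; first by rewrite -(mulgA r).
by exists (w * r); rewrite -{2}wE !mulgA.
Qed.

Lemma zero_simple_right_stable a y : a * y <> z -> exists t, a * y * t = a.
Proof.
move=> ay; have [r [t aE]] := zero_simple_generated a ay.
have [|w wE] := @right_stability _ r a (y * t); first by rewrite {2}aE !mulgA.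
by exists (t * w); rewrite -{2}wE !mulgA.
Qed.

Lemma zero_in_center : z \in center S.
Proof. by rewrite inE; apply/forallP=> x; rewrite zero_mul mul_zero. Qed.

Lemma notin_center_neq0 x : x \notin center S -> x <> z.
Proof. by move=> xC xE; rewrite xE zero_in_center in xC. Qed.

(** For central [x], [x * s * x = s * (x * x)] would vanish for every [s], against primeness. *)
Lemma square_zero_notin_center x : x <> z -> x * x = z -> x \notin center S.
Proof.
move=> x0 xx; apply/negP; rewrite inE => /forallP xC.
have [s] := zero_simple_prime x0 x0; apply.
by rewrite (eqP (xC s)) -mulgA xx mul_zero.
Qed.

(** * Shortening left paths *)

Lemma left_path_length1_of_annihilated a b x t :
  a <> z -> b <> z -> a <> b -> b = a * t -> x <> z ->
  a * x = z -> b * x = z -> left_path_of_length S 1.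
Proof.
move=> a0 b0 ab bE x0 ax bx.
have [s xsa0] := zero_simple_prime x0 a0.
have [r rE] := zero_simple_left_stable xsa0.
(* As [b = a * t], the multiplier [r] that recovers [a] also recovers [b]. Hence [x * s * b] is
   nonzero and differs from [x * s * a]. *)
have rb : r * (x * s * b) = b by rewrite {1}bE !mulgA -(mulgA r) -(mulgA r) rE.
have xsb0 : x * s * b <> z by move=> xsb; apply: b0; rewrite -rb xsb mul_zero.
have prod0 c d : c * x = z -> x * s * c * (x * s * d) = z.
  move=> cx; have -> : x * s * c * (x * s * d) = x * s * (c * x) * (s * d).
    by rewrite !mulgA.
  by rewrite cx mul_zero zero_mul.
apply: (@left_path_of_length1 _ (x * s * a) (x * s * b)); rewrite ?prod0 //;
  try by apply: square_zero_notin_center => //; apply: prod0.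
by move=> uv; apply: ab; rewrite -rE -rb uv.
Qed.

(** Along an edge from [x = q * a] to [y], [a] lies in [S x], so [a * y <> z] forces [x * y <> z];
    then [y = r * (x * y) = r * y * x] lies in [S a]. *)
Lemma cg_path_left_ideal a x p :
  x <> z -> (exists q, x = q * a) -> path (@cg_adj S) x p ->
  {in p, forall y, a * y <> z} -> exists q, last x p = q * a.
Proof.
elim: p x => [|y p IHp] x x0 [q xE] /=; first by exists q.
move=> /andP[/and4P[_ yC _ /eqP xy] pth] ap0.
apply: IHp => //; last by move=> c cp; apply: ap0; rewrite inE cp orbT.
  by apply: notin_center_neq0; rewrite -in_setC.
have qa0 : q * a <> z by rewrite -xE.
have [q' aE] := zero_simple_left_stable qa0.
have xy0 : x * y <> z.
  move=> xyz; apply: (ap0 y (mem_head _ _)).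
  by rewrite -aE -xE -mulgA xyz mul_zero.
have [r yE] := zero_simple_left_stable xy0.
by exists (r * y * q); rewrite -{1}yE xy xE !mulgA.
Qed.

Lemma left_path_length1 x p : left_path x p -> left_path_of_length S 1.
Proof.
case/and3P=> /and3P[xV pth _] /eqP ab /allP eqp.
set b := last x p in ab eqp *.
have eqP' y : y \in x :: p -> x * y = b * y by move/eqp/eqP.
have bp : b \in x :: p by apply: mem_last.
have xp : x \in x :: p by apply: mem_head.
have memV y : y \in x :: p -> y \notin center S.
  rewrite inE => /predU1P[->|]; first by rewrite -in_setC.
  elim: p x pth {xV b ab eqp eqP' bp xp} => //= c p IHp x.
  case/andP=> /and4P[_ cV _ _] pth; rewrite inE => /predU1P[->|].
    by rewrite -in_setC.
  exact: IHp pth.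
have n0 y : y \in x :: p -> y <> z by move/memV/notin_center_neq0.
have xx := eqP' x xp; have xb := eqP' b bp.
have [xx0|/eqP xx0] := eqVneq (x * x) z.
  have bb0 : b * b = z.
    (* Otherwise [b = b * b * t], and [b * b = b * x * b * t = x * x * b * t] vanishes after all. *)
    apply/eqP/negPn/negP=> /eqP bb; have [t bE] := zero_simple_right_stable bb.
    by apply: (bb); rewrite -{2}bE -xb !mulgA -xx xx0 !zero_mul.
  by apply: (@left_path_of_length1 _ x b); rewrite ?memV // -?xx ?xb ?xx0 ?bb0.
have bx0 : b * x <> z by rewrite -xx.
have [t bE] := zero_simple_right_stable bx0.
have [/hasP[y yp /eqP xy]|/hasPn noz] := boolP (has (fun y => x * y == z) p).
  have yxp : y \in x :: p by rewrite inE yp orbT.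
  apply: (@left_path_length1_of_annihilated x b y (x * t)) => //; try exact: n0.
    by rewrite -{1}bE -xx mulgA.
  by rewrite -eqP'.
have [r rE] := zero_simple_left_stable xx0.
have [q bq] : exists q, b = q * x.
  apply: cg_path_left_ideal pth _; first exact: n0.
    by exists (r * x); rewrite -mulgA.
  by move=> y /noz/eqP.
(* Now [x = x * x * s = b * x * s = q * (x * x * s) = q * x = b]. *)
have [s xE] := zero_simple_right_stable xx0.
by case: ab; rewrite -xE xx {1}bq -!mulgA (mulgA x x s) xE -bq.
Qed.

End ZeroSimple.

Theorem corollary9p8 (S : finSemigroupType) (z : S) (hz : is_zero z)
    (hS : completely_zero_simple z) (hnc : noncommutative S)
    (hlp : has_left_paths S) :
  knit_degree hlp = 1.
Proof.
have lp1 : left_path_of_length S 1.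
  case: hlp => n /existsP[x /existsP[p]]; case: hS => hS0 _.
  exact: left_path_length1 hz hS0 _ _.
rewrite /knit_degree; case: ex_minnP => n lpn /(_ 1 lp1).
(* Length [0] is excluded because a path without edges has equal endpoints. *)
case: n lpn => [|[]] // /existsP[x /existsP[p]].
by rewrite (tuple0 p) /left_path /= eqxx andbF.
Qed.
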